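(* Let $p$ be a prime, $N_p=\frac{p^p-1}{p-1}$, and $k\geq 0$ an integer. Then there exists an integer $M_{p,k}\geq 0$ with $$M_{p,k}\equiv 1-(k-1)p-\frac{p^p-p}{(p-1)^2}\pmod{N_p}$$ such that $$A_{M_{p,k}+m+k,\,k}\equiv 0\pmod p\quad\text{for all } 0\leq m\leq p-2.$$ In particular, the sequence $(A_{n+k,k})_{n\geq 0}$ modulo $p$ contains a string of $p-1$ consecutive zeroes.
   Context: A partition of a finite set is a collection of nonempty, pairwise disjoint subsets (blocks) whose union is the set; a singleton of a partition is a block with exactly one element. For integers $0\leq k\leq n$, $A_{n,k}$ denotes the number of partitions of $\{1,2,\dots,n+1\}$ whose largest singleton is $k+1$ (i.e. $\{k+1\}$ is a block and no $j>k+1$ forms a singleton block). The number $\frac{p^p-p}{(p-1)^2}$ is an integer for every prime $p$. *)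

(* Defs.v *)
From mathcomp Require Export all_boot all_order all_algebra.

Set Implicit Arguments.
Unset Strict Implicit.
Unset Printing Implicit Defensive.

(* The set {1, ..., n+1} is 'I_n.+1, the ordinal i standing for i + 1; hence
   the largest singleton is k + 1 exactly when it is the ordinal of value k. *)
Definition largest_singleton n (P : {set {set 'I_n.+1}}) (i : 'I_n.+1) : bool :=
  ([set i] \in P) && [forall j : 'I_n.+1, (i < j) ==> ([set j] \notin P)].

Definition Ank (n k : nat) : nat :=
  #|[set P : {set {set 'I_n.+1}} | partition P [set: 'I_n.+1] &
      [exists i : 'I_n.+1, (i == k :> nat) && largest_singleton P i]]|.

(* Both divisions below are exact: see Np_exact and cp_exact. *)
Definition Np (p : nat) : nat := (p ^ p - 1) %/ (p - 1).

Definition cp (p : nat) : nat := (p ^ p - p) %/ (p - 1) ^ 2.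

Lemma Np_exact p : 0 < p -> Np p * (p - 1) = p ^ p - 1.
Proof.
move=> p_gt0; rewrite divnK //.
by rewrite !subn1 predn_exp dvdn_mulr.
Qed.

Lemma cp_exact p : prime p -> cp p * (p - 1) ^ 2 = p ^ p - p.
Proof.
case: p => [|[|q]] // _; rewrite divnK //.
have -> : q.+2 ^ q.+2 - q.+2 = q.+2 * (q.+1 * \sum_(i < q.+1) q.+2 ^ i).
  by rewrite -(predn_exp q.+2) -subn1 mulnBr muln1 -expnS.
rewrite subn1 /= mulnCA -mulnn dvdn_pmul2l // dvdn_mull //.
rewrite /dvdn -modn_summ.
under eq_bigr => i _ do rewrite -modnXm -(addn1 q.+1) modnDl modnXm exp1n.
by rewrite modn_summ sum_nat_const card_ord muln1 modnn.
Qed.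

(* Main.v *)
(* Let [L] be the linear functional on polynomials with [L(X^n)] the [n]-th Bell
   number. Removing singletons gives [A_(n+k,k) = L(X^k (X-1)^n)], and gathering
   all singletons into one block gives [L(X f(X)) = L(f(X+1))]. Modulo [p] this
   yields [L((X^p - X) f) = L(f)], so [L] factors through [F_p[X]/(X^p - X - 1)],
   where [X |-> X + 1] is the Frobenius map and [X^(N_p)], the norm of [X], is 1.
   Put [c = (p^p - p)/(p-1)^2], so that [(p-1) c = N_p - 1], and let [u = X^(-c)]:
   then [u^p = X u], whence [T(f) = L(X u f)] satisfies [T(f(X+1)) = T(f)].
   Applied to [f = X^(m+1)] this gives [(m+1) T(X^m) = 0] by induction, so [T]
   kills [X^m] for [m <= p-2]; since [(X-1)^p = X], the numbers [T(X^m)] are the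
   required values of [A]. *)
From HB Require Import structures.
Require Import Defs.
From mathcomp Require Import all_boot all_order all_algebra all_field zify.

Set Implicit Arguments.
Unset Strict Implicit.
Unset Printing Implicit Defensive.

(** * Counting partitions with singletons forbidden on a subset *)

Section SingletonFreePartitions.

Implicit Type T : finType.

Definition sfpartitions T (D S : {set T}) : {set {set {set T}}} :=
  [set P | partition P D & [forall y in S, [set y] \notin P]].

Lemma sfpartitionsP T (D S : {set T}) P :
  reflect (partition P D /\ {in S, forall y, [set y] \notin P})
          (P \in sfpartitions D S).
Proof.
rewrite inE; apply: (iffP andP) => [] [pP] sP; split=> //.
- by move=> y yS; move/forall_inP: sP; apply.
- exact/forall_inP.
Qed.

Lemma partition_elemsP T (P : {set {set T}}) (D : {set T}) :
  reflect [/\ set0 \notin P,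
              forall y, y \in D <-> exists2 B, B \in P & y \in B &
              forall B C y, B \in P -> C \in P -> y \in B -> y \in C -> B = C]
          (partition P D).
Proof.
apply: (iffP and3P) => [[/eqP <- /trivIsetP tP ?]|[? cP tP]]; split=> //.
- by move=> y; split=> [/bigcupP|] [B BP yB]; [|apply/bigcupP]; exists B.
- move=> B C y BP CP yB yC; apply/eqP/negPn/negP => nBC.
  by have /disjoint_setI0/setP/(_ y) := tP _ _ BP CP nBC; rewrite !inE yB yC.
- apply/eqP/setP=> y; apply/bigcupP/idP => [|/cP] [B]; last by exists B.
  by move=> BP yB; apply/cP; exists B.
- apply/trivIsetP=> B C BP CP; apply: contraR => /pred0Pn [y /andP [yB yC]].
  by apply/eqP/(tP _ _ y).
Qed.

Lemma card_in_bij (T1 T2 : finType) (A : {set T1}) (B : {set T2}) f g :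
  {in A, forall x, f x \in B} -> {in B, forall y, g y \in A} ->
  {in A, cancel f g} -> {in B, cancel g f} -> #|A| = #|B|.
Proof.
move=> fAB gBA fK gK; rewrite -(card_in_imset (can_in_inj fK)); congr #|pred_of_set _|.
apply/setP=> y; apply/imsetP/idP => [[x xA ->]|yB]; first exact: fAB.
by exists (g y); rewrite ?gK ?gBA.
Qed.

(** Deleting and adjoining the block [[set x]] are mutually inverse; [x \notin S] lets the block be
    adjoined. *)
Lemma card_sfpartitions_singleton T (D S : {set T}) x :
    x \in D -> x \notin S ->
  #|[set P in sfpartitions D S | [set x] \in P]| = #|sfpartitions (D :\ x) S|.
Proof.
move=> xD xS; apply: (@card_in_bij _ _ _ _ (fun P => P :\ [set x]) (fun P => [set x] |: P)).
- move=> P; rewrite inE => /andP [/sfpartitionsP [/partition_elemsP [P0 cP tP] sP] xP].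
  apply/sfpartitionsP; split; last by move=> y yS; rewrite !inE negb_and sP ?orbT.
  apply/partition_elemsP; split; first by rewrite !inE negb_and P0 orbT.
  + move=> y; rewrite !inE; split=> [/andP [yx /cP [B BP yB]]|[B]].
      exists B => //; rewrite !inE BP andbT; apply: contraNneq yx => eB.
      by rewrite -in_set1 -eB.
    rewrite !inE => /andP [Bx BP] yB; apply/andP; split; last by apply/cP; exists B.
    apply: contraNneq Bx => eyx; apply/eqP/(tP _ _ y) => //.
    by rewrite eyx set11.
  + by move=> B C y /setD1P [_ BP] /setD1P [_ CP]; apply: tP.
- move=> P /sfpartitionsP [/partition_elemsP [P0 cP tP] sP].
  have xP B : B \in P -> x \notin B.
    move=> BP; apply/negP=> xB.
    have /cP : exists2 B, B \in P & x \in B by exists B.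
    by rewrite !inE eqxx.
  rewrite inE setU11 andbT; apply/sfpartitionsP; split; last first.
    move=> y yS; rewrite !inE negb_or sP // andbT (inj_eq set1_inj).
    by apply: contraNneq xS => <-.
  apply/partition_elemsP; split.
  + rewrite !inE negb_or P0 andbT eq_sym; apply/set0Pn; exists x; exact: set11.
  + move=> y; split=> [yD|[B /setU1P [->|BP] yB]].
    * have [->|yx] := eqVneq y x; first by exists [set x]; rewrite ?setU11 ?set11.
      have /cP [B BP yB] : y \in D :\ x by rewrite !inE yx.
      by exists B => //; rewrite setU1r.
    * by move: yB; rewrite inE => /eqP ->.
    * have /cP : exists2 B, B \in P & y \in B by exists B.
      by case/setD1P.
  + move=> B C y /setU1P [->|BP] /setU1P [->|CP] //; rewrite ?inE.
    * by move=> /eqP -> /(negP (xP _ CP)).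
    * by move=> yB /eqP eyx; case: (negP (xP _ BP)); rewrite -eyx.
    * exact: tP.
- by move=> P; rewrite inE => /andP [_ xP]; rewrite setD1K.
- move=> P /sfpartitionsP [/partition_elemsP [P0 cP tP] sP].
  rewrite setU1K //; apply/negP => xP.
  have /cP : exists2 B, B \in P & x \in B by exists [set x]; rewrite ?set11.
  by rewrite !inE eqxx.
Qed.

(** Split according to whether [[set x]] is a block. This recurrence mirrors [X = (X - 1) + 1] on
    the polynomial side. *)
Lemma card_sfpartitionsU1 T (D S : {set T}) x :
    x \in D -> x \notin S ->
  #|sfpartitions D S| = #|sfpartitions D (x |: S)| + #|sfpartitions (D :\ x) S|.
Proof.
move=> xD xS; rewrite -card_sfpartitions_singleton //.
rewrite -(cardsID [set P : {set {set T}} | [set x] \in P]) addnC; congr (_ + _).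
  congr #|pred_of_set _|; apply/setP=> P; apply/setDP/sfpartitionsP; rewrite inE.
    case=> /sfpartitionsP [pP sP] xP; split=> // y /setU1P [->|] //; exact: sP.
  case=> pP sP; split; last by apply: sP; rewrite setU11.
  by apply/sfpartitionsP; split=> // y yS; apply: sP; rewrite setU1r.
by congr #|pred_of_set _|; apply/setP=> P; rewrite !inE.
Qed.

(* Dissolving the block of [x] into singletons is undone by adding [x] to the
   set of all singletons. *)
Lemma card_sfpartitions_gather T (D : {set T}) x :
  x \notin D -> #|sfpartitions (x |: D) D| = #|sfpartitions D set0|.
Proof.
move=> xD.
pose f (Q : {set {set T}}) := [set B in Q | x \notin B] :|: set1 @: (pblock Q x :\ x).
(* If [P] has no singletons, the gathered block is [[set x]], which is allowed since only singletons
   of points of [D] are excluded. *)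
pose g (P : {set {set T}}) :=
  (x |: [set y | [set y] \in P]) |: [set B in P | [forall y, B != [set y]]].
have memP P : partition P D -> forall B y, B \in P -> y \in B -> y \in D.
  by case/partition_elemsP=> _ cP _ B y BP yB; apply/cP; exists B.
have xP P : partition P D -> forall B, B \in P -> x \notin B.
  by move=> pP B BP; apply: contra xD; apply: memP BP.
have blockP Q : partition Q (x |: D) -> (pblock Q x \in Q) * (x \in pblock Q x).
  case/and3P=> /eqP cQ _ _; suff xQ : x \in cover Q.
    by rewrite pblock_mem // mem_pblock.
  by rewrite cQ setU11.
have gB : {in sfpartitions D set0, forall P, g P \in sfpartitions (x |: D) D}.
  move=> P /sfpartitionsP [pP _]; have xnP := xP P pP; have DP := memP P pP.
  move/partition_elemsP: (pP) => [P0 cP tP].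
  apply/sfpartitionsP; split.
    apply/partition_elemsP; split.
    * rewrite !inE negb_or negb_and P0 /= andbT eq_sym; apply/set0Pn.
      by exists x; rewrite setU11.
    * move=> y; split=> [/setU1P [->|/cP [B BP yB]]|[B /setU1P [->|]]].
      - by exists (x |: [set y | [set y] \in P]); rewrite setU11.
      - have [/forallP sB|] := boolP [forall z, B != [set z]].
          by exists B => //; rewrite !inE BP orbC; apply/orP; left; apply/forallP.
        rewrite negb_forall => /existsP [z]; rewrite negbK => /eqP eB.
        rewrite eB in yB BP; move/set1P: yB => ->.
        exists (x |: [set y | [set y] \in P]); rewrite ?setU11 //.
        by rewrite !inE BP orbT.
      - case/setU1P => [->|]; first by rewrite setU11.
        by rewrite inE => yP; rewrite setU1r // (DP [set y]) ?set11.
      - by case/setIdP=> BP _ yB; rewrite setU1r // (DP B).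
    * have aux C y : C \in [set B in P | [forall y, B != [set y]]] -> y \in C ->
          y \in x |: [set y | [set y] \in P] -> False.
        case/setIdP=> CP /forallP sC yC /setU1P [eyx|].
          by have := xnP C CP; rewrite -eyx yC.
        rewrite inE => yP; have := sC y; rewrite (tP _ _ y CP yP) ?set11 //.
        by rewrite eqxx.
      move=> B C y /setU1P [->|BP] /setU1P [->|CP] // yB yC.
      - by case: (aux C y).
      - by case: (aux B y).
      - by apply: (tP _ _ y) yB yC; [case/setIdP: BP|case/setIdP: CP].
  move=> y yD; rewrite !inE negb_or negb_and; apply/andP; split.
    apply: contraNneq xD => exy; suff /set1P -> : x \in [set y] by [].
    by rewrite exy setU11.
  by apply/orP; right; apply/forallPn; exists y; rewrite negbK.
apply: (@card_in_bij _ _ _ _ f g).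
- move=> Q /sfpartitionsP [pQ sQ]; have [CQ xC] := blockP Q pQ.
  move/partition_elemsP: (pQ) => [Q0 cQ tQ].
  apply/sfpartitionsP; split; last by move=> y; rewrite inE.
  apply/partition_elemsP; split.
  + rewrite !inE negb_or negb_and Q0 /=; apply/imsetP=> -[y _ /setP/(_ y)].
    by rewrite !inE eqxx.
  + move=> y; split=> [yD|[B /setUP [|/imsetP [z]]]].
    * have yx : y != x by apply: contraNneq xD => <-.
      have /cQ [B BQ yB] : y \in x |: D by rewrite setU1r.
      have [xB|xB] := boolP (x \in B); last first.
        by exists B => //; rewrite !inE BQ xB.
      exists [set y]; rewrite ?set11 // inE imset_f ?orbT // !inE yx.
      by rewrite -(tQ _ _ x BQ CQ xB xC).
    * rewrite inE => /andP [BQ xB] yB.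
      have /cQ /setU1P [eyx|//] : exists2 B, B \in Q & y \in B by exists B.
      by rewrite -eyx yB in xB.
    * move=> /setD1P [zx zC] -> /set1P ->.
      have /cQ /setU1P [ezx|//] : exists2 B, B \in Q & z \in B.
        by exists (pblock Q x).
      by rewrite ezx eqxx in zx.
  + have aux B z y : B \in Q -> x \notin B -> z \in pblock Q x -> y \in B ->
        y \in [set z] -> False.
      move=> BQ xB zC yB /set1P eyz; rewrite -eyz in zC.
      by rewrite (tQ _ _ y BQ CQ yB zC) xC in xB.
    move=> B C y /setUP [/setIdP [BQ xB]|/imsetP [z /setD1P [zx zC] ->]];
      move=> /setUP [/setIdP [CQ' xC']|/imsetP [z' /setD1P [zx' zC'] ->]].
    * exact: tQ.
    * by move=> yB /(aux _ _ _ BQ xB zC' yB).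
    * by move=> yz yC; case: (aux _ _ _ CQ' xC' zC yC yz).
    * by move=> /set1P -> /set1P ->.
- exact: gB.
- move=> Q /sfpartitionsP [pQ sQ]; have [CQ xC] := blockP Q pQ.
  move/partition_elemsP: (pQ) => [Q0 cQ tQ].
  (* Since [Q] has no singleton in [D], every singleton of [f Q] comes from dissolving the block of
     [x], so that block can be recovered. *)
  have eC : x |: [set y | [set y] \in f Q] = pblock Q x.
    apply/setP=> y; apply/setU1P/idP => [[-> //|]|yC].
      rewrite inE => /setUP [/setIdP [yQ xy]|/imsetP [z zC /set1_inj ->]]; last first.
        by case/setD1P: zC.
      have /cQ/setU1P [->//|/sQ] : exists2 B, B \in Q & y \in B.
        by exists [set y]; rewrite ?set11.
      by rewrite yQ.
    have [->|yx] := eqVneq y x; [by left|right].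
    by rewrite !inE imset_f ?orbT // !inE yx.
  rewrite /g eC; apply/setP=> B; apply/setU1P/idP => [[-> //|]|BQ].
    case/setIdP => /setUP [/setIdP [] //|/imsetP [z _ ->] /forallP/(_ z)].
    by rewrite eqxx.
  have [xB|xB] := boolP (x \in B); [left; exact: (tQ _ _ x)|right].
  rewrite !inE BQ xB /=; apply/forallP=> y; apply/eqP => eB.
  have /cQ/setU1P [eyx|/sQ] : exists2 B, B \in Q & y \in B.
  + by exists B; rewrite // eB set11.
  + by rewrite eB eyx set11 in xB.
  + by rewrite -eB BQ.
- move=> P PD; move/sfpartitionsP: (PD) => [pP _]; have xnP := xP P pP.
  move/partition_elemsP: (pP) => [P0 cP tP].
  have /sfpartitionsP [/and3P [_ tg _] _] := gB _ PD.
  have eC : pblock (g P) x = x |: [set y | [set y] \in P].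
    by apply: def_pblock tg _ _; rewrite setU11.
  rewrite /f eC setU1K; last first.
    by rewrite inE; apply/negP=> /xnP; rewrite set11.
  apply/setP=> B; apply/setUP/idP => [[/setIdP [/setU1P [->|]]|]|BP].
  + by rewrite setU11.
  + by case/setIdP.
  + by case/imsetP=> y; rewrite inE => ? ->.
  have [sB|/forallPn [y]] := boolP [forall y, B != [set y]].
    by left; rewrite !inE BP (xnP _ BP) sB orbT.
  by rewrite negbK => /eqP eB; right; apply/imsetP; exists y; rewrite // inE -eB.
Qed.

End SingletonFreePartitions.

(** * Bell numbers *)

Import GRing.Theory.
Local Open Scope ring_scope.

(** The recurrence uses all earlier values, so the whole list is carried along to make the recursion
    structural. *)
Fixpoint bell_seq (n : nat) : seq nat :=
  if n is m.+1 then
    let s := bell_seq m in rcons s (\sum_(i < m.+1) 'C(m, i) * nth 0 s i)%N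
  else [:: 1%N].

Definition bell n := nth 0%N (bell_seq n) n.

Lemma size_bell_seq n : size (bell_seq n) = n.+1.
Proof. by elim: n => //= n IHn; rewrite size_rcons IHn. Qed.

Lemma nth_bell_seq n i : (i <= n)%N -> nth 0%N (bell_seq n) i = bell i.
Proof.
elim: n => [|n IHn]; first by case: i.
rewrite leq_eqVlt => /predU1P [-> //|]; rewrite ltnS => le_in.
by rewrite /= nth_rcons size_bell_seq ltnS le_in IHn.
Qed.

Lemma bellS n : bell n.+1 = (\sum_(i < n.+1) 'C(n, i) * bell i)%N.
Proof.
rewrite {1}/bell /= nth_rcons size_bell_seq ltnn eqxx.
by apply: eq_bigr => i _; rewrite nth_bell_seq // -ltnS.
Qed.

(** * The umbral functional of the Bell numbers *)

Section BellFunctional.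

Variable R : comNzRingType.
Implicit Types f g h : {poly R}.

Definition bellL f : R := \sum_(i < size f) f`_i * (bell i)%:R.

Lemma bellLE n f : (size f <= n)%N -> bellL f = \sum_(i < n) f`_i * (bell i)%:R.
Proof.
move=> le_fn; rewrite /bellL (big_ord_widen _ (fun i => f`_i * (bell i)%:R) le_fn).
rewrite big_mkcond; apply: eq_bigr => i _; case: ltnP => // le_fi.
by rewrite nth_default ?mul0r.
Qed.

Fact bellL_is_linear : linear_for *%R bellL.
Proof.
move=> a f g; pose n := maxn (size f) (size g).
have le_fgn : (size (a *: f + g)%R <= n)%N.
  rewrite (leq_trans (size_polyD _ _)) // geq_max (leq_trans (size_scale_leq _ _));
  by rewrite ?leq_maxl ?leq_maxr.
rewrite (bellLE le_fgn) (@bellLE n f) ?leq_maxl // (@bellLE n g) ?leq_maxr //.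
rewrite mulr_sumr -big_split; apply: eq_bigr => i _ /=.
by rewrite coefD coefZ mulrDl mulrA.
Qed.

HB.instance Definition _ :=
  GRing.isLinear.Build R {poly R} R *%R bellL bellL_is_linear.

Lemma bellLXn n : bellL 'X^n = (bell n)%:R.
Proof.
rewrite /bellL size_polyXn (bigD1 ord_max) //= coefXn eqxx mul1r big1 ?addr0 //.
by move=> i ne_in; rewrite coefXn (negPf (ne_in : (i != n :> nat))) mul0r.
Qed.

Lemma bellL1 : bellL 1 = 1.
Proof. by rewrite -(expr0 'X) bellLXn. Qed.

(** By linearity [f] may be a monomial, and then this is the recurrence [bellS] combined with the
    binomial theorem. *)
Lemma bellLX f : bellL ('X * f) = bellL (f \Po ('X + 1)).
Proof.
rewrite -[f]coefK poly_def mulr_sumr !raddf_sum /=; apply: eq_bigr => i _.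
rewrite comp_polyZ -scalerAr !linearZ /=; congr (_ * _).
rewrite -exprS bellLXn bellS natr_sum rmorphXn /= comp_polyX addrC exprDn raddf_sum /=.
apply: eq_bigr => j _; rewrite expr1n mul1r raddfMn /= bellLXn.
by rewrite natrM mulr_natl.
Qed.

Lemma bellLX_sub1 n : bellL ('X * ('X - 1) ^+ n) = bellL 'X^n.
Proof.
rewrite bellLX; congr bellL.
by rewrite rmorphXn rmorphB /= comp_polyX comp_polyC addrK.
Qed.

(** Each use of [bellLX] absorbs the leading factor [X] and shifts the remaining ones, turning
    [X - (i + 1)] into [X - i]. *)
Lemma bellLX_falling m f :
  bellL (\prod_(i < m) ('X - i%:R) * f) = bellL (f \Po ('X + m%:R)).
Proof.
elim: m f => [|m IHm] f; first by rewrite big_ord0 mul1r addr0 comp_polyXr.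
rewrite big_ord_recl subr0 -mulrA bellLX rmorphM rmorph_prod /=.
rewrite (eq_bigr (fun i : 'I_m => 'X - i%:R)) => [|i _]; last first.
  rewrite rmorphB /= comp_polyX rmorph_nat /bump /= add1n -natr1.
  by rewrite [i%:R + 1]addrC opprD addrA addrK.
by rewrite IHm -comp_polyA rmorphD /= comp_polyX comp_polyC -addrA natr1.
Qed.

(** Induction on the size of [D]. For fixed [D], the recurrence makes the formulas for [S] and
    [y |: S] equivalent, hence those for all [S]; the case [S = D :\ x] then reduces to [D :\ x] by
    gathering singletons. *)
Theorem natr_card_sfpartitions (T : finType) (D S : {set T}) : S \subset D ->
  #|sfpartitions D S|%:R = bellL ('X ^+ (#|D| - #|S|) * ('X - 1) ^+ #|S|).
Proof.
have [d] := ubnP #|D|; elim: d D S => // d IHd D S.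
rewrite ltnS => le_Dd sSD.
have [D0|[x xD]] := set_0Vmem D.
  move: sSD; rewrite D0 subset0 => /eqP ->; rewrite cards0 !expr0 mulr1 bellL1.
  suff -> : sfpartitions (set0 : {set T}) set0 = [set set0] by rewrite cards1.
  apply/setP=> P; rewrite !inE partition_set0; case: eqP => //= _.
  by apply/forall_inP=> y; rewrite inE.
pose ok S := #|sfpartitions D S|%:R
  = bellL ('X ^+ (#|D| - #|S|) * ('X - 1) ^+ #|S|).
have cD1 y : y \in D -> #|D| = #|D :\ y|.+1 by move=> yD; rewrite (cardsD1 y) yD.
have okU1 (S' : {set T}) y : y \in D -> y \notin S' -> S' \subset D -> ok (y |: S') <-> ok S'.
  move=> yD yS sS'D; rewrite /ok (card_sfpartitionsU1 yD yS) natrD.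
  have sS'D1 : S' \subset D :\ y by rewrite subsetD1 sS'D.
  rewrite (IHd (D :\ y) S') -?cD1 // cardsU1 yS (cD1 y yD) add1n subSS.
  rewrite subSn ?subset_leq_card // exprS [in X in _ <-> _ = X]exprS.
  set a := 'X^_; set s := _ ^+ _.
  have -> : bellL ('X * a * s) = bellL (a * (('X - 1) * s)) + bellL (a * s).
    by rewrite -raddfD -mulrDr mulrBl mul1r subrK mulrCA mulrA.
  by split=> [->|/addIr].
have ok0 (S' : {set T}) : S' \subset D -> ok S' <-> ok set0.
  have [n] := ubnP #|S'|; elim: n S' => // n IHn S'.
  have [-> //|[y yS]] := set_0Vmem S'; rewrite (cardsD1 y) yS ltnS => lt_Sn sSD'.
  rewrite -{1}(setD1K yS) okU1 ?setD11 ?(subsetP sSD') //.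
    by apply: IHn; rewrite // (subset_trans (subD1set _ _)).
  by rewrite (subset_trans (subD1set _ _)).
apply/(ok0 S sSD)/(ok0 (D :\ x) (subD1set _ _)).
have := @card_sfpartitions_gather _ (D :\ x) x; rewrite setD11 setD1K // => /(_ isT).
rewrite /ok => ->; rewrite IHd ?sub0set -?cD1 // cards0 subn0 expr0 mulr1.
by rewrite (cD1 x xD) subSn // subnn expr1 bellLX_sub1.
Qed.

Lemma natr_Ank n k : (Ank (n + k) k)%:R = bellL ('X^k * ('X - 1) ^+ n).
Proof.
have lt_k : (k < (n + k).+1)%N by rewrite ltnS leq_addl.
pose i := Ordinal lt_k; pose S := [set j : 'I_(n + k).+1 | (i < j)%N].
have cS : #|S| = n.
  rewrite -sum1_card; transitivity (\sum_(k.+1 <= j < (n + k).+1) 1)%N.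
    by rewrite big_geq_mkord; apply: eq_bigl => j; rewrite inE.
  by rewrite sum_nat_const_nat subSS addnK muln1.
(* [S] consists of the [n] points above [i]; once the block of [i] is removed, [n + k] points
   remain. *)
have -> : Ank (n + k) k = #|[set P in sfpartitions setT S | [set i] \in P]|.
  congr #|pred_of_set _|; apply/setP=> P; rewrite !inE -andbA; congr (_ && _).
  apply/existsP/andP => [[j /andP [/eqP jk /andP [jP /forallP sP]]]|[sP iP]].
    have -> : i = j by apply: val_inj.
    split=> //; apply/forall_inP=> y; rewrite inE => lt_iy.
    by apply: (implyP (sP y)); rewrite jk.
  exists i; rewrite eqxx /largest_singleton iP; apply/forallP=> y.
  by apply/implyP=> lt_iy; apply: (forall_inP sP); rewrite inE.
have iS : i \notin S by rewrite inE ltnn.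
rewrite card_sfpartitions_singleton ?in_setT // natr_card_sfpartitions ?cS.
  by rewrite setTD cardsC1 card_ord /= addKn.
by rewrite subsetD1 subsetT.
Qed.

(* Congruence modulo the largest ideal contained in the kernel of [bellL]. *)
Definition bell_eqv f g := forall h, bellL (f * h) = bellL (g * h).

Lemma bell_eqv_trans g f h : bell_eqv f g -> bell_eqv g h -> bell_eqv f h.
Proof. by move=> fg gh q; rewrite fg. Qed.

Lemma bell_eqvM f g f' g' :
  bell_eqv f g -> bell_eqv f' g' -> bell_eqv (f * f') (g * g').
Proof. by move=> fg fg' h; rewrite -mulrA fg mulrCA fg' mulrCA mulrA. Qed.

Lemma bell_eqvX n f g : bell_eqv f g -> bell_eqv (f ^+ n) (g ^+ n).
Proof. by move=> fg; elim: n => // n IHn; rewrite !exprS; apply: bell_eqvM. Qed.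

Lemma bell_eqv_bellL f g : bell_eqv f g -> bellL f = bellL g.
Proof. by move/(_ 1); rewrite !mulr1. Qed.

End BellFunctional.

(** * Bell numbers modulo a prime *)

Section PrimeModulus.

Variables (p : nat) (p_pr : prime p).

Local Notation F := 'F_p.
Local Notation L := (@bellL F).
Local Notation "f ~~ g" := (@bell_eqv F f g) (at level 70).

Lemma prod_ord_Fp (V : comNzRingType) (G : F -> V) :
  \prod_(i < p) G i%:R = \prod_x G x.
Proof.
rewrite -(big_mkord xpredT (fun i => G i%:R)) -[X in index_iota 0 X](Fp_cast p_pr).
by rewrite big_mkord; apply: eq_bigr => i _; rewrite natr_Zp.
Qed.

Lemma prod_XsubC_Fp : \prod_(i < p) ('X - i%:R) = 'X^p - 'X :> {poly F}.
Proof.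
have := finField_genPoly F; rewrite card_Fp // => ->; rewrite -prod_ord_Fp.
by apply: eq_bigr => i _; rewrite polyC_natr.
Qed.

Lemma prod_XaddC_Fp : \prod_(i < p) ('X + i%:R) = 'X^p - 'X :> {poly F}.
Proof.
have := finField_genPoly F; rewrite card_Fp // => ->; rewrite (reindex_inj oppr_inj) /=.
rewrite -prod_ord_Fp; apply: eq_bigr => i _.
by rewrite polyCN opprK polyC_natr.
Qed.

Let pchar_polyFp : p \in [pchar {poly F}].
Proof. by rewrite pchar_poly pchar_Fp. Qed.

Lemma natr_polyFp : p%:R = 0 :> {poly F}.
Proof. exact: pcharf0 pchar_polyFp. Qed.

(** This is Touchard's congruence: modulo [p] the falling factorial of length [p] is [X^p - X], and
    the shift by [p] it induces is trivial. *)
Lemma XsubX_eqv1 : 'X^p - 'X ~~ 1.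
Proof.
move=> h; rewrite -prod_XsubC_Fp bellLX_falling natr_polyFp addr0 comp_polyXr.
by rewrite mul1r.
Qed.

Lemma Xp_eqv : 'X^p ~~ 'X + 1.
Proof.
by move=> h; rewrite -[in LHS](subrK 'X 'X^p) addrC !mulrDl !raddfD /= -XsubX_eqv1
  mulrDl raddfD.
Qed.

(** Frobenius fixes constants, so each further [p]-th power adds 1. *)
Lemma Xpn_eqv i : 'X^(p ^ i) ~~ 'X + i%:R.
Proof.
elim: i => [|i IHi]; first by rewrite addr0.
rewrite expnSr exprM; apply: bell_eqv_trans (bell_eqvX p IHi) _.
rewrite -(pFrobenius_autE pchar_polyFp) rmorphD rmorph_nat /= pFrobenius_autE.
move=> h; rewrite mulrDl raddfD /= Xp_eqv -raddfD -mulrDl.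
by rewrite -addrA -natr1 [1 + _]addrC.
Qed.

Lemma Np_sum : Np p = (\sum_(i < p) p ^ i)%N.
Proof.
apply/eqP; rewrite -(@eqn_pmul2r (p - 1)) ?subn_gt0 ?prime_gt1 //.
by rewrite Np_exact ?prime_gt0 // !subn1 predn_exp mulnC.
Qed.

(** As [Np p] is the sum of the [p ^ i], this power is the product of the conjugates [X + i], which
    is [X^p - X]. *)
Lemma XNp_eqv1 : 'X^(Np p) ~~ 1.
Proof.
rewrite Np_sum -prodrXr; apply: bell_eqv_trans XsubX_eqv1.
rewrite -prod_XaddC_Fp; apply: (big_ind2 (@bell_eqv F)) => // [*|i _].
  exact: bell_eqvM.
exact: Xpn_eqv.
Qed.

Lemma X_Np_mul_eqv n : 'X^(Np p * n) ~~ 1.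
Proof.
by rewrite exprM; have := bell_eqvX n XNp_eqv1; rewrite expr1n.
Qed.

Lemma Xsub1p_eqv : ('X - 1) ^+ p ~~ 'X.
Proof.
rewrite -(pFrobenius_autE pchar_polyFp) rmorphB rmorph1 /= pFrobenius_autE.
by move=> h; rewrite mulrBl raddfB /= Xp_eqv -raddfB -mulrBl addrK.
Qed.

Lemma cp_mul : (cp p * (p - 1) = Np p - 1)%N.
Proof.
have p1 : (0 < p - 1)%N by rewrite subn_gt0 prime_gt1.
apply/eqP; rewrite -(eqn_pmul2r p1) -mulnA mulnn cp_exact //.
by rewrite mulnBl Np_exact ?prime_gt0 // mul1n -subnDA subnKC ?prime_gt0.
Qed.

(** [X^e] represents [X^(-c)] with a natural exponent, because [X^(Np p)] acts as 1; [cp_lt_Np]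
    shows that the subtraction does not truncate. *)
Let e := (Np p - cp p)%N.

Lemma cp_lt_Np : (cp p < Np p)%N.
Proof.
have p1 : (1 < p)%N := prime_gt1 p_pr.
have N0 : (0 < Np p)%N.
  by rewrite divn_gt0 ?subn_gt0 // leq_sub2r // -{1}(expn1 p) leq_exp2l // ltnW.
have := cp_mul; nia.
Qed.

(** The exponent form of [u^p = X u], obtained from [(p - 1) c = Np p - 1]. *)
Lemma mulp_e : (p * e = e + 1 + Np p * (p - 2))%N.
Proof.
have := cp_mul; have := cp_lt_Np; have := prime_gt1 p_pr; rewrite /e; nia.
Qed.

Let T (f : {poly F}) := L ('X^(e.+1) * f).

(* [X^e] is a (p-1)-st root of [X] modulo [X^p - X - 1], so [T] is invariant
   under Frobenius, which acts there as the shift [X |-> X + 1]. *)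
Lemma T_shift m : T (('X + 1) ^+ m) = T 'X^m.
Proof.
(* The value [L (X^(p (e + m)))] is computed twice: factor by factor it gives the left side, while
   as one [p]-th power it is [L ((X + 1)^(e + m))], which [bellLX] turns into the right side. *)
have -> : T (('X + 1) ^+ m) = L ('X^(p * e) * 'X^(p * m)).
  rewrite mulp_e addn1 exprD -mulrA [in RHS]mulrCA X_Np_mul_eqv mul1r /T.
  by rewrite mulrC exprM [in RHS]mulrC (bell_eqvX m Xp_eqv).
rewrite -exprD -mulnDr exprM (bell_eqv_bellL (bell_eqvX _ Xp_eqv)).
by rewrite /T -exprD addSn exprS bellLX rmorphXn /= comp_polyX.
Qed.

Lemma T_Xn m : (m <= p - 2)%N -> T 'X^m = 0.
Proof.
elim/ltn_ind: m => m IHm le_mp.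
have := T_shift m.+1; rewrite addrC exprDn /T mulr_sumr raddf_sum /=.
(* Terms below [m] vanish by induction and the top term cancels the right side, leaving
   [(m + 1) T(X^m) = 0] with [0 < m + 1 < p]. *)
rewrite big_ord_recr big_ord_recr /= big1 => [|i _]; last first.
  by rewrite expr1n mul1r mulrnAr raddfMn /= -/(T _) IHm ?mul0rn // (leq_trans _ le_mp) // ltnW.
rewrite !expr1n !mul1r binn mulr1n add0r -[RHS]add0r => /addIr.
rewrite binSn mulrnAr raddfMn -mulr_natr => /eqP; rewrite mulf_eq0 => /orP [/eqP //|].
rewrite -(dvdn_pcharf (pchar_Fp p_pr)) => /dvdn_leq-/(_ isT).
by have := prime_gt1 p_pr; lia.
Qed.

Theorem Ank_zero_string k m : (m <= p - 2)%N ->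
  (p %| Ank (p + e.+1 + p * k * (Np p - 1) + m + k) k)%N.
Proof.
move=> le_mp; rewrite (dvdn_pcharf (pchar_Fp p_pr)) natr_Ank.
rewrite -(bell_eqvX k Xsub1p_eqv) -exprM -exprD.
(* [X^k] has been traded for [(X - 1)^(p k)]. The summand [p * k * (Np p - 1)] completes this to
   [(X - 1)^(p * Np p * k)], which acts as 1; the summand [p] supplies the factor [X] needed by
   [bellLX_sub1]. *)
have -> : (p * k + (p + e.+1 + p * k * (Np p - 1) + m)
           = p * (Np p * k) + (p + (e.+1 + m)))%N.
  by have := cp_lt_Np; nia.
rewrite exprD [_ ^+ (p * _)]exprM (bell_eqvX _ Xsub1p_eqv) X_Np_mul_eqv mul1r.
rewrite exprD Xsub1p_eqv bellLX_sub1 exprD; exact/eqP/T_Xn.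
Qed.

End PrimeModulus.

Unset Implicit Arguments.
Local Close Scope ring_scope.

Theorem theorem4p8 (p k : nat) (p_prime : prime p) :
  (exists M : nat,
     (M%:Z = 1 - (k%:Z - 1) * p%:Z - (cp p)%:Z %[mod (Np p)%:Z])%Z%R /\
     (forall m : nat, m <= p - 2 -> Ank (M + m + k) k = 0 %[mod p])) /\
  (exists n : nat, forall m : nat, m < p - 1 -> Ank (n + m + k) k = 0 %[mod p]).
Proof.
set M := p + (Np p - cp p).+1 + p * k * (Np p - 1).
have MP m : m <= p - 2 -> Ank (M + m + k) k = 0 %[mod p].
  by move/(Ank_zero_string p_prime k)/eqP; rewrite mod0n.
split; exists M; last by move=> m lt_mp; apply: MP; lia.
split=> //; apply/eqP; rewrite eqz_mod_dvd; apply/dvdzP.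
(* The terms of [M] outside multiples of [Np p] are [p - c + 1 - p k], exactly the required residue;
   the multiples add up to [(1 + p k) Np p]. *)
exists (1 + (p * k)%N%:Z)%R.
have lt_cN := cp_lt_Np p_prime.
by rewrite /M !PoszD -addn1 PoszD !PoszM -!subzn; lia.
Qed.
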